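(* Let $p'^0$ and $q'^0$ be the post-collision energies, defined by $$p'^0 = \frac{n^0}{2}+\frac{n\cdot\omega}{2},\qquad q'^0=\frac{n^0}{2}-\frac{n\cdot\omega}{2},$$ for given $p,q\in\mathbb{R}^3$ and $\omega\in\mathbb{S}^2$, where $p^0=|p|$, $q^0=|q|$, $n^0=p^0+q^0$ and $n=p+q$. Then, for $r\ge 1$, $$(p'^0)^r + (q'^0)^r - (p^0)^r - (q^0)^r \le C\bigl( (p^0)^{r-1} q^0 + p^0 (q^0)^{r-1}\bigr)$$ for some $C>0$ which depends on $r$. Moreover, there exists $d_r>0$ such that if $\omega$ is restricted to $|n\cdot\omega| \le d_r |n|$, then $$(p'^0)^r + (q'^0)^r - (p^0)^r - (q^0)^r \le C\bigl( (p^0)^{r-1} q^0 + p^0 (q^0)^{r-1}\bigr) - \left(1-\frac{2(1+d_r)^r}{2^r}\right)\bigl((p^0)^r+(q^0)^r\bigr),$$ where $1 - \frac{2(1+d_r)^r}{2^r} > 0$.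
   Context: Here $|\cdot|$ is the Euclidean norm and $n\cdot\omega$ the Euclidean inner product on $\mathbb{R}^3$, and $\mathbb{S}^2$ is the unit sphere in $\mathbb{R}^3$; $p^0=|p|$ is the energy of a massless particle with momentum $p$. The vectors $p,q$ are the momenta of two colliding massless particles, and $\omega$ parametrizes the outcome of the collision.
   Formalization: The positivity 1 − 2(1+d_r)^r/2^r > 0 is claimed only for r > 1, because at r = 1 this expression equals −d_r < 0 for every d_r > 0; both inequalities and the existence of d_r > 0 are still stated for all r ≥ 1. *)

(* Defs.v *)
From mathcomp Require Import all_boot all_order all_algebra.
From mathcomp Require Import reals exp.

Set Implicit Arguments.
Unset Strict Implicit.
Unset Printing Implicit Defensive.

Import Order.TTheory GRing.Theory Num.Theory.
Local Open Scope ring_scope.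

Definition edot (R : realType) (u v : 'rV[R]_3) : R := (u *m v^T) 0 0.

(* Defined here because the norm [`|u|] that MathComp-Analysis puts on row
   vectors is the sup norm. *)
Definition enorm (R : realType) (u : 'rV[R]_3) : R := Num.sqrt (edot u u).

(* Massless particle: the energy p^0 is the Euclidean norm of the momentum. *)
Definition energy (R : realType) (p : 'rV[R]_3) : R := enorm p.

Definition total_energy (R : realType) (p q : 'rV[R]_3) : R :=
  energy p + energy q.

Definition total_momentum (R : realType) (p q : 'rV[R]_3) : 'rV[R]_3 := p + q.

(* Outgoing energies p'^0 and q'^0 in the direction omega; meaningful for omega
   of Euclidean norm 1. *)
Definition post_energy_p (R : realType) (p q omega : 'rV[R]_3) : R :=
  total_energy p q / 2 + edot (total_momentum p q) omega / 2.

Definition post_energy_q (R : realType) (p q omega : 'rV[R]_3) : R :=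
  total_energy p q / 2 - edot (total_momentum p q) omega / 2.

(* [powR] takes junk values at negative bases; all bases here are nonnegative
   when [omega] is a unit vector. *)
Definition moment_gain (R : realType) (r : R) (p q omega : 'rV[R]_3) : R :=
  post_energy_p p q omega `^ r + post_energy_q p q omega `^ r
  - energy p `^ r - energy q `^ r.

(* At r = 1 the convention 0 ^ 0 = 1 of [powR] applies. *)
Definition mixed_moment (R : realType) (r : R) (p q : 'rV[R]_3) : R :=
  energy p `^ (r - 1) * energy q + energy p * energy q `^ (r - 1).

(* Main.v *)
(* With a = p^0, b = q^0 and s = a + b, the outgoing energies x, y are
   nonnegative with x + y = s, because |n . omega| <= |n| <= s. Superadditivity
   gives x^r + y^r <= s^r, and convexity gives
   s^r <= a^r + b^r + 2^r (a^(r-1) b + a b^(r-1)). If |n . omega| <= d |n|, then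
   x and y are at most s (1 + d) / 2, so x^r + y^r <= K s^r with
   K = 2 (1 + d)^r / 2^r, and the bound on s^r is multiplied by K. *)
Require Import Defs.
From mathcomp Require Import all_boot all_order all_algebra.
From mathcomp Require Import reals exp.
From mathcomp Require Import classical_sets interval_inference convex hoelder.
From mathcomp Require Import ring lra.

Import Order.TTheory GRing.Theory Num.Theory.
Local Open Scope ring_scope.

Lemma edotE (R : realType) (u v : 'rV[R]_3) :
  edot u v = u 0 0 * v 0 0 + u 0 1 * v 0 1 + u 0 2%:R * v 0 2%:R.
Proof.
rewrite /edot mxE !big_ord_recl big_ord0 addr0 !mxE addrA.
by congr (_ + u _ _ * v _ _ + u _ _ * v _ _); apply/val_inj.
Qed.

Lemma edot_self_ge0 (R : realType) (u : 'rV[R]_3) : 0 <= edot u u.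
Proof. by rewrite edotE -!expr2 !addr_ge0 ?sqr_ge0. Qed.

Lemma enorm_ge0 (R : realType) (u : 'rV[R]_3) : 0 <= enorm u.
Proof. exact: sqrtr_ge0. Qed.

Lemma sqr_enorm (R : realType) (u : 'rV[R]_3) : enorm u ^+ 2 = edot u u.
Proof. by rewrite sqr_sqrtr ?edot_self_ge0. Qed.

(* Lagrange's identity: the defect in Cauchy-Schwarz is the squared norm of the
   cross product. *)
Lemma edot_cauchy_schwarz {R : realType} (u v : 'rV[R]_3) :
  `|edot u v| <= enorm u * enorm v.
Proof.
rewrite -sqrtrM ?edot_self_ge0// -sqrtr_sqr ler_wsqrtr// -subr_ge0 !edotE.
set a := u 0 0; set b := u 0 1; set c := u 0 2%:R.
set x := v 0 0; set y := v 0 1; set z := v 0 2%:R.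
rewrite (_ : _ - _ = (b * z - c * y) ^+ 2 + (c * x - a * z) ^+ 2
                     + (a * y - b * x) ^+ 2); last by ring.
by rewrite !addr_ge0 ?sqr_ge0.
Qed.

Lemma enorm_triangle (R : realType) (u v : 'rV[R]_3) :
  enorm (u + v) <= enorm u + enorm v.
Proof.
rewrite -(@ler_pXn2r _ 2)// ?nnegrE ?addr_ge0 ?enorm_ge0// sqr_enorm sqrrD.
have := le_trans (ler_norm _) (edot_cauchy_schwarz u v).
rewrite !sqr_enorm !edotE !mxE; lra.
Qed.

(** Write [x^r = x * x^(r-1)], and likewise for [y]. As [r - 1 >= 0], both factors [x^(r-1)] and
    [y^(r-1)] are at most [(x + y)^(r-1)]. *)
Lemma powR_superadditive {R : realType} {r x y : R} :
  1 <= r -> 0 <= x -> 0 <= y -> x `^ r + y `^ r <= (x + y) `^ r.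
Proof.
move=> r1 x0 y0; have r0 : 0 < r by apply: lt_le_trans r1.
rewrite -(mulr_powRB1 x0 r0) -(mulr_powRB1 y0 r0).
rewrite -(mulr_powRB1 (addr_ge0 x0 y0) r0) mulrDl.
by apply: lerD; apply: ler_wpM2l => //; apply: ge0_ler_powR;
  rewrite ?subr_ge0 ?nnegrE ?addr_ge0 ?lerDl ?lerDr.
Qed.

(* For [b <= a] the point [a + b] lies between [a] and [2 a], so convexity of
   the power gives [(a + b)^r <= a^r + (2^r - 1) a^(r-1) b]. *)
Lemma powR_add_le_of_le {R : realType} {r a b : R} :
  1 <= r -> 0 <= b <= a ->
  (a + b) `^ r <= a `^ r + 2 `^ r * (a `^ (r - 1) * b).
Proof.
move=> r1 /andP[b0 ba]; have r0 : 0 < r by apply: lt_le_trans r1.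
have a0 := le_trans b0 ba.
have [az|an0] := eqVneq a 0.
  have -> : b = 0 by apply/le_anti; rewrite b0 -az ba.
  by rewrite addr0 mulr0 mulr0 addr0.
have ap : 0 < a by rewrite lt_def an0 a0.
have t0 : 0 <= b / a by rewrite divr_ge0.
have t1 : b / a <= 1 by rewrite ler_pdivrMr ?mul1r.
(* The weight [b / a] on [2 a] and [1 - b / a] on [a] average to [a + b]; this division is why
   [a = 0] was split off. *)
have := @convex_powR R r r1 (Itv01 t0 t1) (2 * a) a.
rewrite !inE /= !in_itv /= !andbT.
move=> /(_ (mulr_ge0 (ler0n _ 2) a0) a0).
rewrite convRE [X in X `^ _ <= _ -> _]convRE /= /unstable.onem.
have -> : b / a * (2 * a) + (1 - b / a) * a = a + b by field.
have E : b / a * a `^ r = a `^ (r - 1) * b.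
  by rewrite -(mulr_powRB1 a0 r0); field.
have P : 0 <= a `^ (r - 1) * b by rewrite mulr_ge0 ?powR_ge0.
rewrite powRM// => H; apply: (le_trans H).
(* The term [- a^(r-1) b] coming from the weight [1 - b / a] is dropped. *)
by rewrite mulrCA E mulrBl mul1r E addrC lerD2r gerBl.
Qed.

(** Whichever of [a], [b] is larger, the one-sided bound supplies one mixed term; the remaining
    terms are nonnegative. *)
Lemma powR_add_le {R : realType} {r a b : R} :
  1 <= r -> 0 <= a -> 0 <= b ->
  (a + b) `^ r <=
  a `^ r + b `^ r + 2 `^ r * (a `^ (r - 1) * b + a * b `^ (r - 1)).
Proof.
move=> r1 a0 b0; rewrite mulrDr.
have Pr : 0 <= a `^ r by exact: powR_ge0.
have Ps : 0 <= b `^ r by exact: powR_ge0.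
have Pa : 0 <= 2 `^ r * (a `^ (r - 1) * b) by rewrite !mulr_ge0 ?powR_ge0.
have Pb : 0 <= 2 `^ r * (a * b `^ (r - 1)) by rewrite !mulr_ge0 ?powR_ge0.
have [ba|/ltW ab] := leP b a.
  have /(powR_add_le_of_le r1) : 0 <= b <= a by rewrite b0.
  lra.
have /(powR_add_le_of_le r1) : 0 <= a <= b by rewrite a0.
rewrite addrC (mulrC _ a); lra.
Qed.

(* For [1 < r] the witness [d = 2^((r-1)/(2r)) - 1] makes the ratio equal to
   [2^((1-r)/2) < 1]. *)
Lemma exists_aperture {R : realType} {r : R} : 1 <= r ->
  exists d : R, [/\ 0 < d, 2 * (1 + d) `^ r / 2 `^ r <= 2
    & 1 < r -> 2 * (1 + d) `^ r / 2 `^ r < 1].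
Proof.
move=> r1; have r0 : 0 < r by apply: lt_le_trans r1.
have P2 : 0 < (2 : R) `^ r by rewrite powR_gt0.
(* At [r = 1] the ratio is [1 + d], never below 1; [d = 1] attains the bound 2, and the strict claim
   is vacuous. *)
have [->|rn1] := eqVneq r 1.
  by exists 1; rewrite !powRr1// mulfK ?pnatr_eq0// ltxx; split.
have r1' : 1 < r by rewrite lt_def rn1.
have pow2 (x : R) : 0 < x -> 1 < (2 : R) `^ x.
  move=> x0; have := gt0_ltr_powR x0 (x := 1) (y := 2).
  by rewrite powR1 !nnegrE ltr1n; apply.
exists (2 `^ ((r - 1) / (2 * r)) - 1).
have K1 : 2 * (1 + (2 `^ ((r - 1) / (2 * r)) - 1)) `^ r / 2 `^ r < (1 : R).
  rewrite addrC subrK -powRrM ltr_pdivrMr// mul1r.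
  have -> : (r - 1) / (2 * r) * r = (r - 1) / 2 by field; rewrite lt0r_neq0.
  (* With [h = (r - 1) / 2] the claim becomes [2 * 2^h < 2 * 2^h * 2^h], true since [2^h > 1]. *)
  have -> : 2 `^ r = 2 * 2 `^ ((r - 1) / 2) * 2 `^ ((r - 1) / 2) :> R.
    by rewrite -mulrA -powRD ?pnatr_eq0 ?implybT// -splitr mulr_powRB1//.
  rewrite ltr_pMr ?pow2 ?mulr_gt0 ?powR_gt0//; lra.
split=> //; last by lra.
by rewrite subr_gt0 pow2// divr_gt0 ?mulr_gt0// subr_gt0.
Qed.

Theorem lemma2 (R : realType) (r : R) (hr : 1 <= r) :
  exists C : R, 0 < C /\
    (forall p q omega : 'rV[R]_3, enorm omega = 1 ->
       moment_gain r p q omega <= C * mixed_moment r p q) /\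
    (exists d_r : R, 0 < d_r /\
       (1 < r -> 0 < 1 - 2 * (1 + d_r) `^ r / 2 `^ r) /\
       (forall p q omega : 'rV[R]_3, enorm omega = 1 ->
          `|edot (total_momentum p q) omega|
            <= d_r * enorm (total_momentum p q) ->
          moment_gain r p q omega
            <= C * mixed_moment r p q
               - (1 - 2 * (1 + d_r) `^ r / 2 `^ r)
                 * (energy p `^ r + energy q `^ r))).
Proof.
have r0 : 0 < r by apply: lt_le_trans hr.
have P2 : 0 < (2 : R) `^ r by rewrite powR_gt0.
have [d [d0 K2 K1]] := exists_aperture hr.
have M0 p q : 0 <= mixed_moment r p q.
  by rewrite addr_ge0 ?mulr_ge0 ?powR_ge0 ?enorm_ge0.
have sum_le p q : (energy p + energy q) `^ r <=
    energy p `^ r + energy q `^ r + 2 `^ r * mixed_moment r p q.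
  by apply: powR_add_le => //; exact: enorm_ge0.
have n_le (p q : 'rV[R]_3) : enorm (total_momentum p q) <= energy p + energy q.
  exact: enorm_triangle.
(* One constant serves both estimates: the first needs only [2^r], the second needs [K * 2^r] with
   [K <= 2]. *)
exists (2 * 2 `^ r); split; first by rewrite mulr_gt0.
split.
  move=> p q w w1; have := edot_cauchy_schwarz (total_momentum p q) w.
  rewrite w1 mulr1 => /le_trans/(_ (n_le p q)); rewrite ler_norml => /andP[L U].
  have X0 : 0 <= post_energy_p p q w.
    by rewrite /post_energy_p /total_energy; lra.
  have Y0 : 0 <= post_energy_q p q w.
    by rewrite /post_energy_q /total_energy; lra.
  have := powR_superadditive hr X0 Y0.
  have -> : post_energy_p p q w + post_energy_q p q w = energy p + energy q.
    by rewrite /post_energy_p /post_energy_q /total_energy; lra.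
  have := sum_le p q; have := mulr_ge0 (ltW P2) (M0 p q).
  rewrite /moment_gain -mulrA; lra.
exists d; split=> //; split; first by rewrite subr_gt0.
move=> p q w w1 Hd.
have := edot_cauchy_schwarz (total_momentum p q) w.
rewrite w1 mulr1 => /le_trans/(_ (n_le p q)); rewrite ler_norml => /andP[L U].
(* [L] and [U] keep the outgoing energies nonnegative; the aperture condition adds
   [|n . omega| <= d s], which bounds them above. *)
have := le_trans Hd (ler_wpM2l (ltW d0) (n_le p q)).
rewrite ler_norml => /andP[Ld Ud].
set s := energy p + energy q in L U Ld Ud.
have s0 : 0 <= s by rewrite addr_ge0 ?enorm_ge0.
have post_le (x : R) : 0 <= x -> x <= s * ((1 + d) / 2) ->
    x `^ r <= s `^ r * ((1 + d) `^ r / 2 `^ r).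
  move=> x0 xs; have D0 : 0 <= (1 + d) / 2 by lra.
  have -> : (1 + d) `^ r / 2 `^ r = ((1 + d) / 2) `^ r.
    by apply: (canLR (mulfK (lt0r_neq0 P2))); rewrite -powRM// divfK.
  by rewrite -powRM// ge0_ler_powR ?nnegrE ?(mulr_ge0 s0 D0) ?(ltW r0).
have Hx : post_energy_p p q w `^ r <= s `^ r * ((1 + d) `^ r / 2 `^ r).
  by apply: post_le; rewrite /post_energy_p /total_energy -/s; lra.
have Hy : post_energy_q p q w `^ r <= s `^ r * ((1 + d) `^ r / 2 `^ r).
  by apply: post_le; rewrite /post_energy_q /total_energy -/s; lra.
set K := 2 * (1 + d) `^ r / 2 `^ r in K1 K2 *.
have K0 : 0 <= K by rewrite /K !mulr_ge0 ?invr_ge0 ?powR_ge0.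
have := ler_wpM2l K0 (sum_le p q); rewrite -/s.
have := ler_wpM2r (mulr_ge0 (ltW P2) (M0 p q)) K2.
have : post_energy_p p q w `^ r + post_energy_q p q w `^ r <= K * s `^ r.
  by apply: le_trans (lerD Hx Hy) _; rewrite /K -mulrA mulrC; lra.
(* Subtracting [a^r + b^r] from [K (a^r + b^r)] leaves the negative term with factor [1 - K]. *)
rewrite /moment_gain; lra.
Qed.
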